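(* The Gelfand-Kirillov dimension of every finitely generated bicommutative superalgebra over a field of characteristic different from $2$ is a nonnegative integer.
   Context: Algebras are not assumed associative or unital. A superalgebra is an algebra $A=A_0\oplus A_1$ with $A_iA_j\subseteq A_{i+j\,(\mathrm{mod}\,2)}$; for $a\in A_i$ write $\overline a=i$. A superalgebra is bicommutative if for all homogeneous elements $x_1(x_2x_3)=(-1)^{\overline{x_1}\,\overline{x_2}}x_2(x_1x_3)$ and $(x_1x_2)x_3=(-1)^{\overline{x_2}\,\overline{x_3}}(x_1x_3)x_2$. For a finitely generated algebra $A$ let $V$ be the subspace spanned by a finite system of generators. The growth function is $g_V(n)=\dim(V^0+V^1+\cdots+V^n)$, where $V^0=K$ if $A$ is unital, $V^0=0$ for algebras without $1$, and $V^n$ is spanned by all products of $n$ elements of $V$ with arbitrary arrangement of parentheses. The Gelfand-Kirillov dimension is $\mathrm{GKdim}(A)=\limsup_{n\to\infty}\log_n(g_V(n))$, which does not depend on the choice of the finite generating system. *)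

(* Defs.v *)
From HB Require Import structures.
From mathcomp Require Import all_boot all_order all_algebra.
From mathcomp Require Import all_classical all_reals all_analysis.

Set Implicit Arguments.
Unset Strict Implicit.
Unset Printing Implicit Defensive.

Import Order.TTheory GRing.Theory Num.Theory.

Local Open Scope classical_set_scope.
Local Open Scope ring_scope.

(* The parity group Z/2 is [bool]: addition is [(+)] and multiplication [&&]. *)
Record superalgebra (K : fieldType) := Superalgebra {
  sa_carrier :> lmodType K;
  sa_mul : {bilinear sa_carrier -> sa_carrier -> sa_carrier};
  homog : bool -> set sa_carrier;
  homog_submod : forall i, GRing.submod_closed [in homog i];
  homog_sum : forall x, exists2 x0, homog false x0 &
    exists2 x1, homog true x1 & x = x0 + x1;
  homog_direct : forall x, homog false x -> homog true x -> x = 0;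
  homog_mul : forall i j x y, homog i x -> homog j y ->
    homog (i (+) j) (sa_mul x y) }.

Arguments sa_mul {K s}.
Arguments homog {K s} i _.

Definition bicommutative (K : fieldType) (A : superalgebra K) : Prop :=
  forall (i1 i2 i3 : bool) (x1 x2 x3 : A),
    homog i1 x1 -> homog i2 x2 -> homog i3 x3 ->
    sa_mul x1 (sa_mul x2 x3) = (-1) ^+ (i1 && i2) *: sa_mul x2 (sa_mul x1 x3) /\
    sa_mul (sa_mul x1 x2) x3 = (-1) ^+ (i2 && i3) *: sa_mul (sa_mul x1 x3) x2.

Section LinearAlgebra.
Variables (K : fieldType) (E : lmodType K).

Definition linear_span (S : set E) : set E :=
  [set x | exists (n : nat) (c : 'I_n -> K) (v : 'I_n -> E),
    (forall i, S (v i)) /\ x = \sum_(i < n) c i *: v i].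

Definition lin_indep (d : nat) (e : 'I_d -> E) : Prop :=
  forall c : 'I_d -> K, \sum_(i < d) c i *: e i = 0 -> forall i, c i = 0.

Definition has_dimension (S : set E) (d : nat) : Prop :=
  exists e : 'I_d -> E, lin_indep e /\ linear_span (range e) = S.

(* Junk value 0 when [S] is not a finite-dimensional subspace. *)
Definition dimension (S : set E) : nat := xget 0%N [set d | has_dimension S d].

End LinearAlgebra.

Section Growth.
Variables (K : fieldType) (A : superalgebra K).

Definition identity_element (e : A) : Prop :=
  forall x, sa_mul e x = x /\ sa_mul x e = x.

(* If [A] is unital, its identity element counts as generated for free, in
   accordance with the convention V^0 = K below. *)
Definition generates (X : seq A) : Prop :=
  forall S : set A, GRing.submod_closed [in S] ->
    (forall x y, S x -> S y -> S (sa_mul x y)) ->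
    (forall e, identity_element e -> S e) ->
    (forall x, x \in X -> S x) ->
    S = setT.

Definition finitely_generated : Prop := exists X : seq A, generates X.

Inductive product_of (V : set A) : nat -> A -> Prop :=
| product_of_one v : V v -> product_of V 1 v
| product_of_mul m n x y : product_of V m x -> product_of V n y ->
    product_of V (m + n) (sa_mul x y).

(* For n = 0 this is the line spanned by the identity element if [A] is unital,
   and the zero subspace otherwise. *)
Definition power_space (V : set A) (n : nat) : set A :=
  if n is 0%N then linear_span [set e | identity_element e]
  else linear_span [set x | product_of V n x].

Definition power_sum (V : set A) (n : nat) : set A :=
  [set x | exists v : 'I_n.+1 -> A,
    (forall i : 'I_n.+1, power_space V i (v i)) /\ x = \sum_(i < n.+1) v i].

Definition growth (V : set A) (n : nat) : nat := dimension (power_sum V n).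

(* Since [ln 0 = 0], the zero algebra gets dimension 0; the terms n = 0, 1, where
   log_n is meaningless, do not affect the limsup. *)
Definition GKdim_wrt (R : realType) (V : set A) : \bar R :=
  limn_esup (fun n : nat => (ln (growth V n)%:R / ln n%:R)%:E).

(* The dimension is well defined only as far as it is independent of the
   generating system, so "GKdim(A) = d" asks for the value d on all of them. *)
Definition GKdim_eq (R : realType) (d : \bar R) : Prop :=
  forall X : seq A, generates X ->
    GKdim_wrt R (linear_span [set x | x \in X]) = d.

End Growth.

(* Main.v *)
Require Import Defs.
From HB Require Import structures.
From mathcomp Require Import all_boot all_order all_algebra.
From mathcomp Require Import all_classical all_reals all_analysis.
From mathcomp Require Import -(notations) mpoly.

(** Why the dimension is an integer.  Let [y] be a finite list of homogeneous
    generators.  On products [u * v] of homogeneous elements, left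
    multiplications commute with each other up to sign, so do right
    multiplications, and a left multiplication commutes with a right one up to
    sign because both [a((uv)b)] and [(a(uv))b] reduce to [(ub)(av)].  Moreover
    every product of [n >= 2] generators is, up to sign, a word of length
    [n - 2] in the left and right multiplications by generators, applied to a
    product [y_i y_j]: this is [product_of_generators].  So the square of [A]
    behaves like a finitely generated module over a polynomial ring in finitely
    many sign-commuting variables, with basis candidates the monomials
    [x^a (y_i y_j)].

    Growth of such a module is read off leading monomials.  Call a monomial
    normal when it is not a combination of smaller ones for a degree-compatible
    monomial order.  Normal monomials are independent, those of degree at most
    [n] span everything of degree at most [n], and a divisor of a normal
    monomial is normal ([normal_independent], [normal_span], [normal_lem]).
    Hence the growth counts points of a downward closed set [D] of exponents, one
    such set for each module generator.
    Let [d] be the largest size of a set [S] of variables such that all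
    exponents supported on [S] lie in [D].  Those exponents alone give at least
    [n^d] points of degree [O(n)].  Conversely, each larger [S] has an exponent
    outside [D], so for some [N] no point of [D] has more than [d] coordinates
    above [N], which leaves only [O(n^d)] points of degree at most [n]
    ([free_face_dichotomy], [card_few_large]).  This bypasses Hilbert
    polynomials and chain conditions altogether.

    Two-sided bounds of order [n^d], up to rescaling [n], give the limit [d] for
    [log_n] of the growth ([limn_esup_log]); and they pass from the homogeneous
    generating system to any other one, since each system lies in a fixed term
    of the filtration defined by the other ([generates_comparable]). *)

Set Implicit Arguments.
Unset Strict Implicit.
Unset Printing Implicit Defensive.

Import Order.TTheory GRing.Theory Num.Theory.

Local Open Scope ring_scope.

(** * Spans and dimensions *)

Section LinearSpan.
Variables (K : fieldType) (E : lmodType K).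
Implicit Types (S T : set E).

Lemma submodP S : GRing.submod_closed [in S] <->
  S 0 /\ forall a u v, S u -> S v -> S (a *: u + v).
Proof.
split=> [[S0 SD]|[S0 SD]]; split.
- by move: S0; rewrite inE.
- by move=> a u v Su Sv; move: (SD a u v); rewrite !inE; apply.
- by rewrite inE.
- by move=> a u v; rewrite !inE; apply: SD.
Qed.

Section Submodule.
Variable S : set E.
Hypothesis subS : GRing.submod_closed [in S].

Lemma submod0 : S 0. Proof. by case/submodP: subS. Qed.

Lemma submodZ a u : S u -> S (a *: u).
Proof.
by move=> Su; case/submodP: subS => S0 SD; rewrite -[_ *: _]addr0; apply: SD.
Qed.

Lemma submodD u v : S u -> S v -> S (u + v).
Proof.
by move=> Su Sv; case/submodP: subS => _ SD; rewrite -[u]scale1r; apply: SD.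
Qed.

Lemma submod_sum (I : Type) (r : seq I) (P : pred I) (F : I -> E) :
  (forall i, P i -> S (F i)) -> S (\sum_(i <- r | P i) F i).
Proof.
by move=> SF; elim/big_ind: _ => //; [exact: submod0|exact: submodD].
Qed.

Lemma linear_span_min T : (T `<=` S)%classic -> (linear_span T `<=` S)%classic.
Proof.
move=> TS x [n [c [v [Tv ->]]]]; apply: submod_sum => i _.
by apply: submodZ; apply: TS.
Qed.

End Submodule.

Lemma linear_span_submod S : GRing.submod_closed [in linear_span S].
Proof.
apply/submodP; split.
  by exists 0%N, (fun=> 0), (fun=> 0); split=> [[]|] //; rewrite big_ord0.
move=> a _ _ [m [c [u [Su ->]]]] [n [d [v [Sv ->]]]].
exists (m + n)%N.
exists (fun i => match fintype.split i with inl j => a * c j | inr j => d j end).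
exists (fun i => match fintype.split i with inl j => u j | inr j => v j end).
split=> [i|]; first by case: (fintype.split i).
rewrite big_split_ord /= scaler_sumr; congr (_ + _); apply: eq_bigr => i _.
  by rewrite (unsplitK (inl i)) scalerA.
by rewrite (unsplitK (inr i)).
Qed.

Lemma sub_linear_span S : (S `<=` linear_span S)%classic.
Proof.
move=> x Sx; exists 1%N, (fun=> 1), (fun=> x); split=> //.
by rewrite big_ord1 scale1r.
Qed.

Lemma linear_span_sub S T :
  (S `<=` linear_span T)%classic -> (linear_span S `<=` linear_span T)%classic.
Proof. by apply: linear_span_min; apply: linear_span_submod. Qed.

Lemma linear_spanS S T :
  (S `<=` T)%classic -> (linear_span S `<=` linear_span T)%classic.
Proof. by move=> ST; apply: linear_span_sub => x /ST; exact: sub_linear_span. Qed.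

Lemma linear_span_range (I : finType) (f : I -> E) x :
  linear_span (range f) x -> exists c : I -> K, x = \sum_i c i *: f i.
Proof.
pose T := [set y | exists c : I -> K, y = \sum_i c i *: f i]%classic.
suff: (linear_span (range f) `<=` T)%classic by move=> fT fx; exact: fT fx.
apply: linear_span_min.
  apply/submodP; split.
    by exists (fun=> 0); rewrite big1 // => i _; rewrite scale0r.
  move=> a _ _ [c ->] [d ->]; exists (fun i => a * c i + d i).
  rewrite scaler_sumr -big_split; apply: eq_bigr => i _ /=.
  by rewrite scalerDl scalerA.
move=> _ [i _ <-]; exists (fun j => (j == i)%:R).
rewrite (bigD1 i) //= eqxx scale1r big1 ?addr0 // => j /negbTE ->.
by rewrite scale0r.
Qed.

(** The index is any finite type, so that families indexed by exponents or by
    subsets need no renumbering; for ordinals this is [lin_indep]. *)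
Definition independent (I : finType) (e : I -> E) : Prop :=
  forall c : I -> K, \sum_i c i *: e i = 0 -> forall i, c i = 0.

(** The exchange inequality: more than [#|J|] combinations of [#|J|] vectors
    have a coefficient matrix with a nonzero row kernel, hence a relation. *)
Lemma independent_card (I J : finType) (e : I -> E) (f : J -> E) :
  independent e -> (forall i, linear_span (range f) (e i)) -> (#|I| <= #|J|)%N.
Proof.
move=> indep_e spe.
have /choice[c ec] i := linear_span_range (spe i).
pose M := \matrix_(i < #|I|, j < #|J|) c (enum_val i) (enum_val j).
rewrite leqNgt; apply/negP => ltJI.
have : kermx M != 0.
  rewrite kermx_eq0 -row_leq_rank -ltnNge;
    exact: leq_ltn_trans (rank_leq_col M) ltJI.
rewrite -nz_row_eq0; set u := nz_row _; apply/negP; rewrite negbK.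
have uM : u *m M = 0 by apply/sub_kermxP; exact: nz_row_sub.
apply/eqP/rowP => i; rewrite mxE -(enum_valK i).
apply: (indep_e (fun i => u 0 (enum_rank i))).
transitivity (\sum_j (\sum_i u 0 (enum_rank i) * c i j) *: f j).
  under eq_bigr do rewrite ec scaler_sumr.
  rewrite exchange_big /=; apply: eq_bigr => j _; rewrite scaler_suml.
  by apply: eq_bigr => k _; rewrite scalerA.
rewrite big1 // => j _.
have := congr1 (fun A : 'rV__ => A 0 (enum_rank j)) uM.
rewrite !mxE (reindex (@enum_rank I)) /=; last exact/onW_bij/enum_rank_bij.
under eq_bigr do rewrite mxE !enum_rankK.
by move=> ->; rewrite scale0r.
Qed.

Lemma independent_extend d (e : 'I_d -> E) x :
  independent e -> ~ linear_span (range e) x ->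
  independent (fun i : 'I_d.+1 => oapp e x (unlift ord0 i)).
Proof.
move=> indep_e Nx c; rewrite big_ord_recl unlift_none /=.
under eq_bigr do rewrite liftK /=.
move=> rel.
have c0 : c ord0 = 0.
  apply/eqP/negPn/negP => nz_c; apply: Nx.
  rewrite -[x]scale1r -(mulVf nz_c) -scalerA.
  move/eqP: rel; rewrite addr_eq0 => /eqP ->.
  have subE := linear_span_submod (range e).
  rewrite -scaleN1r; do 2![apply: submodZ => //].
  by apply: submod_sum => // i _; apply: submodZ => //; apply: sub_linear_span;
    exists i.
move: rel; rewrite c0 scale0r add0r => /indep_e ci i.
by case: (unliftP ord0 i) => [j ->|->].
Qed.

(** A maximal independent family spans, and the bound makes one exist. *)
Lemma has_dimension_bounded S N : GRing.submod_closed [in S] ->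
  (forall d (e : 'I_d -> E),
     independent e -> (forall i, S (e i)) -> (d <= N)%N) ->
  exists d, has_dimension S d.
Proof.
move=> subS bound.
pose P d := `[< exists2 e : 'I_d -> E, independent e & forall i, S (e i) >].
have exP : exists d, P d.
  by exists 0%N; apply/asboolP; exists (fun=> 0) => [c _|] [].
have ubP d : P d -> (d <= N)%N by case/asboolP=> e; exact: bound.
case: (ex_maxnP exP ubP) => d /asboolP[e indep_e Se] maxd.
exists d, e; split=> //; apply/seteqP; split.
  by apply: linear_span_min => // _ [i _ <-].
move=> x Sx; apply: contrapT => /(independent_extend indep_e) indep_ex.
suff /maxd : P d.+1 by rewrite ltnn.
apply/asboolP; exists (fun i => oapp e x (unlift ord0 i)); first exact: indep_ex.
by move=> i; case: (unlift ord0 i) => [j|] /=.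
Qed.

Section FiniteSpan.
Variables (S : set E) (J : finType) (f : J -> E).
Hypotheses (subS : GRing.submod_closed [in S])
  (Sf : (S `<=` linear_span (range f))%classic).

Lemma has_dimension_dimension : has_dimension S (dimension S).
Proof.
have bound d (e : 'I_d -> E) :
    independent e -> (forall i, S (e i)) -> (d <= #|J|)%N.
  by move=> ie Se; rewrite -[d]card_ord;
    apply: (independent_card (f := f) ie) => i; exact: Sf.
by have [d dS] := has_dimension_bounded subS bound; apply: (xgetPex 0%N);
  exists d.
Qed.

Lemma dimension_le_card : (dimension S <= #|J|)%N.
Proof.
have [e [ie eS]] := has_dimension_dimension.
rewrite -[X in (X <= _)%N]card_ord; apply: (independent_card (f := f) ie) => i.
by apply: Sf; rewrite -eS; apply: sub_linear_span; exists i.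
Qed.

Lemma independent_le_dimension (I : finType) (e : I -> E) :
  independent e -> (forall i, S (e i)) -> (#|I| <= dimension S)%N.
Proof.
move=> ie Se; have [b [ib bS]] := has_dimension_dimension.
rewrite -[X in (_ <= X)%N]card_ord; apply: (independent_card (f := b) ie) => i.
by rewrite bS.
Qed.

End FiniteSpan.

Lemma dimensionS S T (J : finType) (f : J -> E) :
  GRing.submod_closed [in S] -> GRing.submod_closed [in T] ->
  (T `<=` linear_span (range f))%classic -> (S `<=` T)%classic ->
  (dimension S <= dimension T)%N.
Proof.
move=> subS subT Tf ST; have [b [_ bT]] := has_dimension_dimension subT Tf.
rewrite -[X in (_ <= X)%N]card_ord; apply: (@dimension_le_card _ _ b) => //.
by rewrite bT.
Qed.

End LinearSpan.

(** * Normal elements of a family indexed by a well-order *)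

Section Normal.
Variables (K : fieldType) (E : lmodType K).
Variables (disp : Order.disp_t) (I : orderType disp) (b : I -> E).

(** These are the standard monomials of Groebner basis theory: the indices that
    are not leading terms of a linear relation. *)
Definition normal (i : I) : Prop :=
  ~ linear_span [set b j | j in [set j | (j < i)%O]]%classic (b i).

(** The largest index with a nonzero coefficient in a relation would fail to be
    normal. *)
Lemma normal_independent (J : finType) (u : J -> I) :
  injective u -> (forall j, normal (u j)) -> independent (b \o u).
Proof.
move=> inj_u nu c rel j0; apply/eqP/negPn/negP => nz0.
(* The largest index carrying a nonzero coefficient. *)
case: (@arg_maxP _ _ _ j0 (fun j => c j != 0) u nz0) => j nzj maxj.
apply: (nu j); rewrite -[b _]scale1r -(mulVf nzj) -scalerA.
move/eqP: rel; rewrite (bigD1 j) //= addr_eq0 => /eqP ->; rewrite -scaleN1r.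
have subE := linear_span_submod [set b i | i in [set i | (i < u j)%O]]%classic.
do 2![apply: submodZ => //]; apply: submod_sum => // k nkj.
have [->|nzk] := eqVneq (c k) 0; first by rewrite scale0r; exact: submod0.
apply: submodZ => //; apply: sub_linear_span; exists (u k) => //=.
by rewrite lt_neqAle (inj_eq inj_u) nkj /=; exact: maxj.
Qed.

(** An element that is not normal is rewritten with smaller ones, and the
    rewriting stops by well-foundedness.  As it never leaves the indices below
    [i], a bound on the degree is preserved. *)
Lemma normal_span i : well_founded (fun j k : I => (j < k)%O) ->
  linear_span [set b j | j in [set j | normal j /\ (j <= i)%O]]%classic (b i).
Proof.
move=> wf; elim/(well_founded_ind wf): i => i IHi.
have [ni|/contrapT] := pselect (normal i).
  by apply: sub_linear_span; exists i.
apply: linear_span_sub => _ [j ltji <-].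
apply: linear_spanS (IHi j ltji) => _ [k [nk lekj] <-]; exists k => //.
by split=> //; apply: le_trans lekj (ltW ltji).
Qed.

End Normal.

(** * Exponents of normal monomials *)

Lemma linear_span_image (K : fieldType) (E F : lmodType K)
    (f : {linear E -> F}) (S : set E) (T : set F) x :
  (forall s, S s -> linear_span T (f s)) -> linear_span S x ->
    linear_span T (f x).
Proof.
move=> fS [n [c [v [Sv ->]]]]; rewrite linear_sum.
apply: submod_sum => [|i _]; first exact: linear_span_submod.
by rewrite linearZ; apply: submodZ (fS _ (Sv i)); exact: linear_span_submod.
Qed.

(** Monomials are compared by total degree, then lexicographically; the index of
    the module generator only breaks ties. *)
Lemma lexi_wf (m k : nat) :
  well_founded (fun s t : multinom m *l 'I_k => (s < t)%O).
Proof.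
move=> [a j]; elim/(well_founded_ind (@ltom_wf m)): a j => a IHa j.
have [n ltjn] : exists n : nat, (j < n)%N by exists j.+1.
elim: n j ltjn => [|n IHn] j ltjn; first by rewrite ltn0 in ltjn.
constructor=> -[a' j']; rewrite ltxi_pair => /andP[].
rewrite le_eqVlt => /predU1P[-> | lta _]; last exact: IHa.
rewrite lexx /= => ltj; apply: IHn; exact: leq_trans ltj _.
Qed.

(** From here on [b (a, j)] stands for the monomial of exponent [a] in operators
    [T i], applied to the [j]-th module generator.  Only the shift rule is
    assumed, and only up to a nonzero scalar, which absorbs the signs. *)
Section MonomialFamily.
Variables (K : fieldType) (E : lmodType K) (m k : nat).
Variables (b : multinom m *l 'I_k -> E) (T : 'I_m -> {linear E -> E}).

Hypothesis T_shift : forall i a j, exists2 c : K, c != 0 &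
  T i (b (a, j)) = c *: b (mnm_add a (mnm1 i), j).

(** Applying [T i] to a relation with leading term [(a, j)] gives one with leading
    term the shift of [(a, j)]. *)
Lemma normal_shift i a j : normal b (mnm_add a (mnm1 i), j) -> normal b (a, j).
Proof.
apply: contra_not => ba; have [c nzc Tc] := T_shift i a j.
rewrite -[b _]scale1r -(mulVf nzc) -scalerA -Tc; apply: submodZ.
  exact: linear_span_submod.
apply: linear_span_image ba => _ [[a' j'] lta' <-].
have [c' _ ->] := T_shift i a' j'; apply: submodZ;
  first exact: linear_span_submod.
apply: sub_linear_span; exists (mnm_add a' (mnm1 i), j') => //=.
move: lta' => /=; rewrite !ltxi_pair lemc_add2l => /andP[-> /=].
by apply: contraTT; rewrite lemc_add2l.
Qed.

Lemma normal_lem a a' j : lem a a' -> normal b (a', j) -> normal b (a, j).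
Proof.
move=> le_a; rewrite -(submK le_a); set d := mnm_sub _ _.
have [n] := ubnP (mdeg d); elim: n d => // n IHn d ltdn.
have [->|nz_d] := eqVneq d mnm0; first by rewrite add0m.
have [i nz_di] : exists i, d i != 0%N.
  by apply/existsP; apply: contraNT nz_d => /existsPn d0; apply/eqP/mnmP => i;
     rewrite mnm0E; apply/eqP/negPn.
have le1d : lem (mnm1 i) d by rewrite lep1mP.
move: ltdn; rewrite -(submK le1d) mdegD mdeg1 addn1 ltnS => ltdn.
by rewrite -addmA [mnm_add (mnm1 i) a]addmC addmA => /normal_shift; exact: IHn.
Qed.

End MonomialFamily.

(** * Counting exponents *)

(** Choose the set of the at most [d] coordinates above [K] in at most [2 ^ m]
    ways; these take any of [n.+1] values, the others at most [K.+1]. *)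
Lemma card_few_large (m n K d : nat) :
  (#|[pred f : {ffun 'I_m -> 'I_n.+1} | #|[set i | (K < f i)%N]| <= d]|
     <= 2 ^ m * (n.+1 ^ d * K.+1 ^ m))%N.
Proof.
pose large (f : {ffun 'I_m -> 'I_n.+1}) := [set i | (K < f i)%N].
rewrite -sum1_card (partition_big large (fun S => #|S| <= d)%N) //=.
apply: (@leq_trans (\sum_(S : {set 'I_m} | (#|S| <= d)%N) n.+1 ^ d * K.+1 ^ m)).
  apply: leq_sum => S leSd.
  pose F i : {pred 'I_n.+1} := [pred x : 'I_n.+1 | (i \in S) || (x <= K)%N].
  apply: (@leq_trans #|family F|).
    rewrite -sum1_card [leqRHS]big_mkcond [leqLHS]big_mkcond;
      apply: leq_sum => f _ /=.
    case: ifP => // /andP[_ /eqP fS]; rewrite ifT //; apply/familyP => i.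
    have -> : (f i \in F i) = (K < f i)%N || (f i <= K)%N by rewrite inE -fS inE.
    by case: leqP.
  rewrite card_family foldrE big_image /=.
  apply: (@leq_trans (\prod_i ((if i \in S then n.+1 else 1) * K.+1))%N).
    apply: leq_prod => i _; case: ifP => iS.
      by apply: leq_trans (max_card _) _; rewrite card_ord leq_pmulr.
    rewrite mul1n -[leqRHS]card_ord;
      apply: (leq_card_in (fun x : 'I_n.+1 => inord x : 'I_K.+1)) => x y.
    rewrite !inE iS /= => lexK leyK /(congr1 (@nat_of_ord _)).
    by rewrite !inordK // => /val_inj.
  rewrite big_split /= -big_mkcond /= !prod_nat_const card_ord leq_mul2r.
  by rewrite leq_pexp2l ?orbT.
rewrite sum_nat_const leq_mul2r; apply/orP; right.
rewrite -[X in (_ <= 2 ^ X)%N]card_ord -cardsT -card_powerset.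
by apply: subset_leq_card; apply/fintype.subsetP => S _;
  rewrite powersetE finset.subsetT.
Qed.

(** The exponents supported on [S] form a face of the orthant, and [d] is the
    largest dimension of a face contained in [D].  If the face of [S] is not
    contained in [D], some exponent [a] on it lies outside, hence so does every
    exponent whose coordinates on [S] are all at least [mdeg a]; finitely many
    faces give a common bound. *)
Lemma free_face_dichotomy (m k : nat) (D : 'I_k -> multinom m -> Prop) :
  (forall j a a', lem a a' -> D j a' -> D j a) ->
  exists d : nat,
    ((0 < d)%N -> exists j (S : {set 'I_m}),
       #|S| = d /\ forall a : multinom m, (forall i, i \notin S ->
         a i = 0%N) -> D j a) /\
    (exists K : nat, forall j a, D j a -> (#|[set i | (K < a i)%N]| <= d)%N).
Proof.
move=> downD.
pose face (p : 'I_k * {set 'I_m}) :=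
  `[< forall a : multinom m, (forall i, i \notin p.2 -> a i = 0%N) -> D p.1 a >].
exists (\max_(p | face p) #|p.2|)%N; split.
  case: (pickP face) => [p0 face_p0 _|face0]; last by rewrite big_pred0.
  have [|[j S] /asboolP face_p ->] := @eq_bigmax_cond _ face (fun p => #|p.2|).
    by apply/card_gt0P; exists p0.
  by exists j, S.
have /choice[Kp KpP] p : exists K : nat, face p \/
    forall a, D p.1 a -> ~ (forall i, i \in p.2 -> (K < a i)%N).
  have [|/asboolP/existsNP[a /not_implyP[supp_a nDa]]] := boolP (face p).
    by exists 0%N; left.
  exists (mdeg a); right=> a' Da' lea; apply: nDa; apply: downD Da'.
  apply/mnm_lepP => i; have [iS|/supp_a ->] := boolP (i \in p.2); last by [].
  apply: leq_trans (ltnW (lea i iS)); rewrite mdegE (bigD1 i) //=;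
    exact: leq_addr.
exists (\max_p Kp p)%N => j a Da; rewrite leqNgt; apply/negP => ltdS.
pose p := (j, [set i | (\max_p Kp p < a i)%N]).
have [face_p|/(_ a Da)] := KpP p.
  by move: ltdS;
    rewrite ltnNge (@leq_bigmax_cond _ _ (fun p : 'I_k * {set 'I_m} => #|p.2|) p).
apply=> i; rewrite inE; apply: leq_ltn_trans.
exact: (@leq_bigmax _ Kp).
Qed.

Section MonomialGrowth.
Variables (K : fieldType) (E : lmodType K) (m k : nat).
Variables (b : multinom m *l 'I_k -> E) (T : 'I_m -> {linear E -> E}).

Hypothesis T_shift : forall i a j, exists2 c : K, c != 0 &
  T i (b (a, j)) = c *: b (mnm_add a (mnm1 i), j).

(** The growth of a finitely generated module over (sign-)commuting operators
    has order [n ^ d], stated separately as spanning families from above and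
    independent families from below. *)
Lemma monomial_family_growth : exists d : nat,
  (exists C : nat, forall n, exists (J : finType) (f : J -> E),
     (#|J| <= C * n.+1 ^ d)%N /\
     forall a j, (mdeg a <= n)%N -> linear_span (range f) (b (a, j))) /\
  ((0 < d)%N -> forall n, exists (J : finType) (u : J -> multinom m * 'I_k),
     [/\ (n ^ d <= #|J|)%N, independent (fun x => b (u x)) &
         forall x, (mdeg (u x).1 <= m * n)%N]).
Proof.
have [|d [lower [N upper]]] :=
  @free_face_dichotomy m k (fun j a => normal b (a, j)).
  by move=> j a a'; exact: (normal_lem T_shift).
exists d; split=> [|d_gt0 n].
  exists (2 ^ m * N.+1 ^ m * k)%N => n.
  (* Coordinates are at most [n], so exponents become functions to ['I_n.+1]. *)
  pose few : pred {ffun 'I_m -> 'I_n.+1} :=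
    [pred f : {ffun 'I_m -> 'I_n.+1} | #|[set i | (N < f i)%N]| <= d]%N.
  exists ({f | few f} * 'I_k)%type.
  pose expo (f : {f | few f}) := Multinom [tuple (sval f i : nat) | i < m].
  exists (fun p => b (expo p.1, p.2)).
  split=> [|a j ledn].
    rewrite card_prod card_sig card_ord mulnAC leq_mul2r.
    rewrite (leq_trans (card_few_large _ _ _ _)) ?orbT //.
    by rewrite -mulnA [(n.+1 ^ d * _)%N]mulnC.
  apply: linear_spanS (@normal_span _ _ _ _ b (a, j) (@lexi_wf m k)).
  move=> _ [[a' j'] /= [na' lea'] <-].
  have lta' i : (a' i < n.+1)%N.
    rewrite ltnS; apply: leq_trans ledn; apply: (@leq_trans (mdeg a')).
      by rewrite mdegE (bigD1 i) //= leq_addr.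
    by move: lea'; rewrite lexi_pair => /andP[/lemc_mdeg].
  pose f := [ffun i => Ordinal (lta' i)].
  have few_f : few f.
    rewrite /few /=; apply: leq_trans (upper _ _ na'); apply: subset_leq_card.
    by apply/fintype.subsetP => i; rewrite !inE ffunE.
  exists (Sub f few_f, j') => //=; congr (b (_, j')).
  by apply/mnmP => i; rewrite mnmE ffunE.
have [j [S [cardS face_S]]] := lower d_gt0.
pose J := {ffun {i | i \in S} -> 'I_n}.
pose expo (h : J) := Multinom [tuple (oapp (fun s => h s : nat) 0%N (insub i))
  | i < m].
have expoE (h : J) i : expo h i = oapp (fun s => h s : nat) 0%N (insub i) by
  exact: mnmE.
have inj_u : injective (fun h : J => (expo h, j) : multinom m *l 'I_k).
  move=> h h' /(congr1 (fun p : multinom m *l 'I_k => p.1)) /mnmP eq_h;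
    apply/ffunP => s; apply/val_inj.
  by have := eq_h (val s); rewrite !expoE valK.
exists J, (fun h => (expo h, j)); split=> [||h].
- by rewrite card_ffun card_ord card_sig -cardS.
- apply: (normal_independent inj_u) => h; apply: face_S => i niS.
  by rewrite expoE insubN.
rewrite mdegE -[X in (_ <= X * _)%N]card_ord -sum_nat_const;
  apply: leq_sum => i _.
by rewrite expoE; case: insub => //= s; apply: ltnW.
Qed.

End MonomialGrowth.

(** * Polynomial growth and the limit of logarithms *)

(** The order [n ^ d] up to a constant factor above and a rescaling of [n] below.
    For [d = 0] no lower bound is imposed, since the zero algebra has growth
    zero. *)
Definition polynomial_growth (d : nat) (g : nat -> nat) : Prop :=
  (exists C : nat, forall n, (0 < n)%N -> (g n <= C * n ^ d)%N) /\
  ((0 < d)%N -> exists2 c : nat, (0 < c)%N & forall n, (n ^ d <= g (c * n))%N).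

Lemma polynomial_growth_rescale d g h k l : (0 < k)%N -> (0 < l)%N ->
  (forall n, g n <= h (k * n))%N -> (forall n, h n <= g (l * n))%N ->
  polynomial_growth d h -> polynomial_growth d g.
Proof.
move=> k_gt0 l_gt0 gh hg [[C hC] lower]; split.
  exists (C * k ^ d)%N => n n_gt0; apply: leq_trans (gh n) _.
  by rewrite -mulnA -expnMn hC // muln_gt0 k_gt0.
move=> /lower[c c_gt0 hc]; exists (l * c)%N; first by rewrite muln_gt0 l_gt0.
by move=> n; rewrite -mulnA; apply: leq_trans (hc n) (hg _).
Qed.

Section LogLimit.
Import numFieldNormedType.Exports.
Variable R : realType.
Local Open Scope classical_set_scope.

Lemma cvg_ln_natV : (ln n%:R : R)^-1 @[n --> \oo] --> (0 : R).
Proof.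
apply/gtr0_cvgV0.
  by near=> n; rewrite ln_gt0 // ltr1n; near: n; exact: nbhs_infty_gt.
apply/cvgryPge => A.
have /cvgryPge/(_ (expR A)) := @cvgr_idn R.
apply: filterS => n leAn; rewrite -[A]expRK ler_ln ?posrE ?expR_gt0 //.
exact: lt_le_trans (expR_gt0 A) leAn.
Unshelve. all: by end_near. Qed.

(** The constants contribute terms of order [1 / ln n].  For the lower bound,
    [g n >= q ^ d] with [q] the quotient of [n] by [c], and [n <= 2 * c * q]. *)
Lemma limn_esup_log d (g : nat -> nat) :
  {homo g : m n / (m <= n)%N} -> polynomial_growth d g ->
  limn_esup (fun n => (ln (g n)%:R / ln n%:R : R)%:E) = d%:R%:E.
Proof.
move=> homo_g [[C gC] lower].
suff cvg_g : (ln (g n)%:R / ln n%:R : R) @[n --> \oo] --> (d%:R : R).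
  have cvgE : (ln (g n)%:R / ln n%:R : R)%:E @[n --> \oo] --> (d%:R : R)%:E.
    by apply: cvg_EFin => //; near=> n.
  rewrite is_cvg_limn_esupE; first exact/cvg_lim.
  by apply/cvg_ex; exists d%:R%:E.
have [c c_gt0 gc] : exists2 c : nat, (0 < c)%N &
    forall n, (0 < d)%N -> (n ^ d <= g (c * n))%N.
  by have [/lower[c c0 gc]|_] := ltnP 0 d; [exists c|exists 1%N].
have cvg_aff (a : R) : d%:R + a * (ln n%:R)^-1 @[n --> \oo] --> (d%:R : R).
  rewrite -[X in _ --> X]addr0 -[X in _ + X](mulr0 a).
  by apply: cvgD; [exact: cvg_cst|apply: cvgMr; exact: cvg_ln_natV].
apply: (squeeze_cvgr _ (cvg_aff (- (d%:R * ln (2 * c)%:R)))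
  (cvg_aff (ln C.+1%:R))).
near=> n.
have n_gt1 : (1 < n)%N by near: n; exact: nbhs_infty_gt.
have lecn : (c <= n)%N by near: n; exact: nbhs_infty_ge.
have n_gt0 : (0 < n)%N by apply: ltnW.
have ln_n : 0 < ln n%:R :> R by rewrite ln_gt0 // ltr1n.
have ln_nat_ge0 k : 0 <= ln k%:R :> R.
  by case: k => [|k]; [rewrite ln0|apply: ln_ge0; rewrite ler1n].
have ln_le k l : (k <= l)%N -> ln k%:R <= ln l%:R :> R.
  case: k => [|k] lekl; first by rewrite ln0.
  by rewrite ler_ln ?posrE ?ltr0n ?ler_nat //; apply: leq_trans lekl.
rewrite ler_pdivlMr // ler_pdivrMr // !mulrDl !mulfVK ?gt_eqF //.
apply/andP; split.
  rewrite -mulrBr; have [d_gt0|] := ltnP 0 d; last first.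
    by rewrite leqn0 => /eqP->; rewrite mul0r.
  pose q := (n %/ c)%N.
  have q_gt0 : (0 < q)%N by rewrite divn_gt0.
  have le_qg : (q ^ d <= g n)%N.
    apply: leq_trans (gc q d_gt0) _; apply: homo_g; rewrite mulnC;
      exact: leq_divM.
  apply: le_trans (ln_le _ _ le_qg); rewrite natrX lnXn ?ltr0n //.
  rewrite -[leRHS]mulr_natl ler_wpM2l // lerBlDl -lnM ?posrE ?ltr0n ?muln_gt0 //.
  rewrite -natrM ln_le //; apply: ltnW; apply: (leq_trans (ltn_ceil n c_gt0)).
  by rewrite mulnC -mulnA mulnCA leq_mul2l mul2n -addnn -addn1 leq_add2l q_gt0
    orbT.
apply: le_trans (ln_le _ (C.+1 * n ^ d)%N _) _.
  by apply: leq_trans (gC n n_gt0) _; rewrite leq_mul2r leqnSn orbT.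
rewrite natrM lnM ?posrE ?ltr0n ?expn_gt0 ?n_gt0 // natrX lnXn ?ltr0n //.
by rewrite addrC mulr_natl.
Unshelve. all: by end_near. Qed.

End LogLimit.

(** * Filtrations attached to generating systems *)

Section Filtration.
Variables (K : fieldType) (A : superalgebra K).
Local Open Scope classical_set_scope.
Implicit Types (S T U V W : set A) (X Y : seq A).

Lemma linear_span_mul S T U x y :
  (forall s t, S s -> T t -> linear_span U (sa_mul s t)) ->
  linear_span S x -> linear_span T y -> linear_span U (sa_mul x y).
Proof.
move=> STU Sx Ty.
suff: linear_span U (applyr (@sa_mul K A) y x) by [].
apply: linear_span_image Sx => s Ss; rewrite /applyr.
by apply: linear_span_image Ty => t Tt; exact: STU.
Qed.

(** Merging the summands [V^i] into a single spanning set turns the questions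
    about the filtration into questions about words. *)
Definition short_words V (n : nat) : set A :=
  [set x | identity_element x \/ exists2 i, (i <= n)%N & product_of V i x].

Lemma product_of_gt0 V n x : product_of V n x -> (0 < n)%N.
Proof. by elim=> // m p u v _ m_gt0 _ _; rewrite addn_gt0 m_gt0. Qed.

Lemma power_space_submod V n : GRing.submod_closed [in power_space V n].
Proof. by case: n => [|n]; exact: linear_span_submod. Qed.

Lemma power_sumE V n : power_sum V n = linear_span (short_words V n).
Proof.
apply/seteqP; split.
  move=> _ [v [Vv ->]]; apply: submod_sum; first exact: linear_span_submod.
  case=> -[|i] lei _; move: (Vv (Ordinal lei)); apply: linear_spanS => x Vx;
    first by left.
  by right; exists i.+1.
apply: linear_span_min.
  apply/submodP; split.
    exists (fun=> 0); split; last by rewrite big1.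
    by move=> i; apply: submod0; exact: power_space_submod.
  move=> a _ _ [u [Vu ->]] [v [Vv ->]]; exists (fun i => a *: u i + v i).
  rewrite scaler_sumr -big_split; split=> // i.
  have subV := @power_space_submod V i.
  by apply: submodD => //; exact: submodZ.
have in_sum i x : (i <= n)%N -> power_space V i x -> power_sum V n x.
  rewrite -ltnS => lti Vx; exists (fun j => if j == Ordinal lti then x else 0);
    split.
    by move=> j; case: eqP => [->|_] //; apply: submod0;
      exact: power_space_submod.
  by rewrite -big_mkcond big_pred1_eq.
move=> x [idx|[i lei Vx]]; first by apply: (in_sum 0%N) => //;
  exact: sub_linear_span.
apply: (in_sum i) => //; case: i Vx {lei} => [/product_of_gt0|i Vx] //.
exact: sub_linear_span.
Qed.

Lemma power_sum_submod V n : GRing.submod_closed [in power_sum V n].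
Proof. by rewrite power_sumE; exact: linear_span_submod. Qed.

Lemma power_sumS V m n : (m <= n)%N -> power_sum V m `<=` power_sum V n.
Proof.
move=> lemn; rewrite !power_sumE; apply: linear_spanS => x [?|[i lei Vx]];
  first by left.
by right; exists i => //; exact: leq_trans lemn.
Qed.

(** The filtration is multiplicative; an identity element, of filtration degree
    zero, is absorbed by the other factor. *)
Lemma power_sum_mul V m n x y :
  power_sum V m x -> power_sum V n y -> power_sum V (m + n) (sa_mul x y).
Proof.
rewrite !power_sumE; apply: linear_span_mul => s t Vs Vt; apply: sub_linear_span.
case: Vs => [ids|[i lei Vs]].
  rewrite (ids t).1; case: Vt => [?|[i lei Vt]]; [by left|right; exists i => //].
  exact: leq_trans lei (leq_addl _ _).
right; case: Vt => [idt|[j lej Vt]].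
  by rewrite (idt s).2; exists i => //; exact: leq_trans lei (leq_addr _ _).
by exists (i + j)%N; [exact: leq_add|exact: product_of_mul].
Qed.

Lemma power_sum_product V k W n x : V `<=` power_sum W k ->
  product_of V n x -> power_sum W (k * n) x.
Proof.
move=> VW; elim=> [v /VW|m p u v _ Wu _ Wv]; first by rewrite muln1.
by rewrite mulnDr; exact: power_sum_mul.
Qed.

Lemma power_sum_sub V W k n : V `<=` power_sum W k ->
  power_sum V n `<=` power_sum W (k * n).
Proof.
move=> VW; rewrite [X in X `<=` _]power_sumE.
apply: linear_span_min => [|x [idx|[i lei Vx]]]; first exact: power_sum_submod.
  by rewrite power_sumE; apply: sub_linear_span; left.
by apply: power_sumS (power_sum_product VW Vx); rewrite leq_mul2l lei orbT.
Qed.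

(** The union of the filtration is a subalgebra containing the generators. *)
Lemma generates_power_sum X x : generates X ->
  exists n, power_sum (linear_span [set x | x \in X]) n x.
Proof.
move=> genX; set V := linear_span _.
suff allV : [set x | exists n, power_sum V n x] = setT.
  by have : setT x by []; rewrite -allV.
apply: genX.
- apply/submodP; split; first by exists 0%N; apply: submod0;
  exact: power_sum_submod.
  move=> a u v [m Vu] [n Vv]; exists (m + n)%N.
  have subV := power_sum_submod V (m + n); apply: submodD => //.
    by apply: submodZ => //; apply: power_sumS Vu; exact: leq_addr.
  by apply: power_sumS Vv; exact: leq_addl.
- by move=> u v [m Vu] [n Vv]; exists (m + n)%N; exact: power_sum_mul.
- by move=> e ide; exists 0%N; rewrite power_sumE; apply: sub_linear_span; left.
- move=> u Xu; exists 1%N; rewrite power_sumE; apply: sub_linear_span; right.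
  by exists 1%N => //; apply: product_of_one; exact: sub_linear_span.
Qed.

Lemma generates_comparable X Y : generates Y -> exists2 k : nat, (0 < k)%N &
  forall n, power_sum (linear_span [set x | x \in X]) n `<=`
            power_sum (linear_span [set y | y \in Y]) (k * n).
Proof.
move=> genY; set V := linear_span [set y | y \in Y].
have [k Xk] : exists k : nat, forall x, x \in X -> power_sum V k x.
  elim: X => [|x X [k Xk]]; first by exists 0%N.
  have [l Vx] := generates_power_sum x genY; exists (k + l)%N => z.
  rewrite inE => /predU1P[->|/Xk Vz].
    by apply: power_sumS Vx; exact: leq_addl.
  by apply: power_sumS Vz; exact: leq_addr.
exists k.+1 => // n; apply: power_sum_sub; apply: linear_span_min.
  exact: power_sum_submod.
by move=> x /Xk; apply: power_sumS.
Qed.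

Lemma product_of_span S n x :
  product_of (linear_span S) n x -> linear_span (product_of S n) x.
Proof.
elim=> [v|m p u v _ Su _ Sv].
  by apply: linear_spanS => ? ?; exact: product_of_one.
apply: linear_span_mul Su Sv => s t Ss St.
by apply: sub_linear_span; exact: product_of_mul.
Qed.

Lemma product_ofS S T n x : S `<=` T -> product_of S n x -> product_of T n x.
Proof.
move=> ST; elim=> [v /ST|m p u v _ Tu _ Tv]; first exact: product_of_one.
exact: product_of_mul.
Qed.

(** By bilinearity only products of the spanning elements matter. *)
Lemma power_sum_span S n : power_sum (linear_span S) n = power_sum S n.
Proof.
rewrite !power_sumE; apply/seteqP; split; apply: linear_span_sub => x.
  move=> [idx|[i lein Sx]]; first by apply: sub_linear_span; left.
  by apply: linear_spanS (product_of_span Sx) => u Su; right; exists i.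
move=> [idx|[i lein Sx]]; apply: sub_linear_span; first by left.
by right; exists i => //; apply: product_ofS Sx; exact: sub_linear_span.
Qed.

Lemma identity_unique e f : identity_element e -> identity_element f ->
  e = f :> A.
Proof. by move=> ide idf; rewrite -(idf e).1 (ide f).2. Qed.

Lemma homogeneous_generators X : generates X ->
  exists2 Y : seq A, generates Y & forall y, y \in Y -> exists i, homog i y.
Proof.
move=> genX; pose parts x (y : A * A) :=
  [/\ homog false y.1, homog true y.2 & x = y.1 + y.2].
have /choice[h hP] x : exists y, parts x y.
  by have [x0 hx0 [x1 hx1 ->]] := homog_sum x; exists (x0, x1).
exists ([seq (h x).1 | x <- X] ++ [seq (h x).2 | x <- X]).
  move=> S subS mulS idS YS; apply: genX => // x Xx.
  have [_ _ ->] := hP x; apply: submodD => //; apply: YS; rewrite mem_cat.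
    by apply/orP; left; apply/mapP; exists x.
  by apply/orP; right; apply/mapP; exists x.
move=> y; rewrite mem_cat => /orP[] /mapP[x _ ->]; have [? ? _] := hP x.
  by exists false.
by exists true.
Qed.

End Filtration.

(** * The square of a bicommutative superalgebra *)

Section Proportional.
Variables (K : fieldType) (E : lmodType K).
Implicit Types u v w : E.

(** Nonzero scalars do not change spans, so working up to them absorbs every
    sign of the superalgebra identities. *)
Definition proportional u v : Prop := exists2 c : K, c != 0 & u = c *: v.

Lemma proportional_refl u : proportional u u.
Proof. by exists 1; rewrite ?oner_eq0 ?scale1r. Qed.

Lemma proportional_sym u v : proportional u v -> proportional v u.
Proof.
move=> [c nzc ->]; exists c^-1; first by rewrite invr_eq0.
by rewrite scalerA mulVf // scale1r.
Qed.

Lemma proportional_trans v u w :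
  proportional u v -> proportional v w -> proportional u w.
Proof.
move=> [c nzc ->] [d nzd ->]; exists (c * d); first by rewrite mulf_neq0.
by rewrite scalerA.
Qed.

Lemma proportional_sign b u : proportional ((-1) ^+ b *: u) u.
Proof. by exists ((-1) ^+ b); rewrite ?signr_eq0. Qed.

Lemma proportional_span (S : set E) u v :
  proportional u v -> linear_span S v -> linear_span S u.
Proof.
move=> [c _ ->]; apply: submodZ; exact: linear_span_submod.
Qed.

End Proportional.

Lemma proportional_linear (K : fieldType) (E F : lmodType K) (f : {linear E ->
  F}) u v :
  proportional u v -> proportional (f u) (f v).
Proof. by move=> [c nzc ->]; exists c => //; rewrite linearZ. Qed.

Section Bicommutative.
Variables (K : fieldType) (A : superalgebra K) (bicomA : bicommutative A).
Local Notation "u ** v" := (@sa_mul K A u v) (at level 40, left associativity).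

Definition homogeneous (u : A) : Prop := exists p, homog p u.

Definition homogeneous_product (z : A) : Prop :=
  exists u v, [/\ homogeneous u, homogeneous v & z = u ** v].

Lemma homogeneous_mul u v : homogeneous u -> homogeneous v ->
  homogeneous (u ** v).
Proof. by move=> [p hu] [q hv]; exists (p (+) q); exact: homog_mul. Qed.

Lemma homogeneous_product_homogeneous z : homogeneous_product z -> homogeneous z.
Proof. by move=> [u [v [hu hv ->]]]; exact: homogeneous_mul. Qed.

Lemma lcomm u v w : homogeneous u -> homogeneous v -> homogeneous w ->
  proportional (u ** (v ** w)) (v ** (u ** w)).
Proof.
move=> [p hu] [q hv] [r hw]; rewrite (bicomA hu hv hw).1;
  exact: proportional_sign.
Qed.

Lemma rcomm u v w : homogeneous u -> homogeneous v -> homogeneous w ->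
  proportional ((u ** v) ** w) ((u ** w) ** v).
Proof.
move=> [p hu] [q hv] [r hw]; rewrite (bicomA hu hv hw).2;
  exact: proportional_sign.
Qed.

Lemma proportional_mull u v w : proportional v w ->
  proportional (u ** v) (u ** w).
Proof. exact: (@proportional_linear _ _ _ (@sa_mul K A u)). Qed.

Lemma proportional_mulr u v w : proportional v w ->
  proportional (v ** u) (w ** u).
Proof. exact: (@proportional_linear _ _ _ (applyr (@sa_mul K A) u)). Qed.

(** For [z = ab] both sides reduce to [(av)(ub)].  This is where [z] has to be a
    product: left and right multiplications need not commute on generators. *)
Lemma lrcomm u v z : homogeneous u -> homogeneous v -> homogeneous_product z ->
  proportional (u ** (z ** v)) ((u ** z) ** v).
Proof.
move=> hu hv [a [b [ha hb ->]]].
apply: (@proportional_trans _ _ ((a ** v) ** (u ** b))).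
  apply: (@proportional_trans _ _ (u ** ((a ** v) ** b))).
    by apply: proportional_mull; exact: rcomm.
  by apply: lcomm => //; exact: homogeneous_mul.
apply: (@proportional_trans _ _ ((a ** (u ** b)) ** v)).
  by apply: rcomm => //; exact: homogeneous_mul.
by apply: proportional_mulr; exact: lcomm.
Qed.

Variables (s : nat) (y : 'I_s -> A) (homog_y : forall i, homogeneous (y i)).

(** Left multiplications come first and right ones second, so that [s + s]
    variables index them all. *)
Definition op (i : 'I_(s + s)) : {linear A -> A} :=
  match fintype.split i with
  | inl j => @sa_mul K A (y j)
  | inr j => applyr (@sa_mul K A) (y j)
  end.

Lemma op_lshift j z : op (lshift s j) z = y j ** z.
Proof. by rewrite /op (unsplitK (inl j)). Qed.

Lemma op_rshift j z : op (rshift s j) z = z ** y j.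
Proof. by rewrite /op (unsplitK (inr j)). Qed.

Lemma op_product i z : homogeneous_product z -> homogeneous_product (op i z).
Proof.
move=> /homogeneous_product_homogeneous hz.
by rewrite -(splitK i); case: (fintype.split i) => j /=;
   rewrite ?op_lshift ?op_rshift; [exists (y j), z|exists z, (y j)].
Qed.

Lemma op_comm i j z : homogeneous_product z ->
  proportional (op i (op j z)) (op j (op i z)).
Proof.
move=> pz; have hz := homogeneous_product_homogeneous pz.
rewrite -(splitK i) -(splitK j).
case: (fintype.split i) (fintype.split j) => i' [] j' /=;
  rewrite ?op_lshift ?op_rshift.
- exact: lcomm.
- exact: lrcomm.
- by apply: proportional_sym; exact: lrcomm.
- exact: rcomm.
Qed.

Definition ops (w : seq 'I_(s + s)) (z : A) : A := foldr (fun i => op i) z w.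

Lemma ops_product w z : homogeneous_product z -> homogeneous_product (ops w z).
Proof. by move=> pz; elim: w => //= i w; exact: op_product. Qed.

Lemma ops_insert i w w' z : homogeneous_product z ->
  proportional (ops (w ++ i :: w') z) (op i (ops (w ++ w') z)).
Proof.
move=> pz; elim: w => [|j w IHw] /=; first exact: proportional_refl.
apply: (@proportional_trans _ _ (op j (op i (ops (w ++ w') z)))).
  exact: proportional_linear.
by apply: op_comm; exact: ops_product.
Qed.

Lemma ops_perm w w' z : homogeneous_product z -> perm_eq w w' ->
  proportional (ops w z) (ops w' z).
Proof.
move=> pz; elim: w w' => [|i w IHw] w' eqw.
  by move: eqw; rewrite perm_sym => /perm_nilP ->; exact: proportional_refl.
have iw' : i \in w' by rewrite -(perm_mem eqw) mem_head.
case: (path.splitPr iw') eqw => w1 w2 eqw.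
apply: (@proportional_trans _ _ (op i (ops (w1 ++ w2) z))).
  apply: proportional_linear; apply: IHw.
  by move: eqw; rewrite perm_sym -cat1s perm_catCA perm_cons perm_sym.
by apply: proportional_sym; exact: ops_insert.
Qed.

(** The sorted word representing an exponent. *)
Definition word_of (a : multinom (s + s)) : seq 'I_(s + s) :=
  flatten [seq nseq (a i) i | i <- enum 'I_(s + s)].

Lemma count_word_of a i : count_mem i (word_of a) = a i.
Proof.
rewrite count_flatten -map_comp sumnE big_map big_enum (bigD1 i) //=.
rewrite count_nseq /= eqxx mul1n big1 ?addn0 // => j /negbTE nji.
by rewrite count_nseq /= nji.
Qed.

Lemma size_word_of a : size (word_of a) = mdeg a.
Proof.
rewrite size_flatten /shape -map_comp sumnE big_map big_enum mdegE /=.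
by apply: eq_bigr => i _; rewrite size_nseq.
Qed.

Lemma perm_word_of_shift i a :
  perm_eq (i :: word_of a) (word_of (mnm_add a (mnm1 i))).
Proof.
apply/allP => j _ /=; rewrite !count_word_of mnmDE mnm1E addnC.
by rewrite addnC.
Qed.

Lemma perm_word_of w : exists a, perm_eq w (word_of a).
Proof.
elim: w => [|i w [a pa]].
  by exists mnm0; apply/allP => j _ /=; rewrite count_word_of mnm0E.
exists (mnm_add a (mnm1 i)).
by apply: perm_trans (perm_word_of_shift i a); rewrite perm_cons.
Qed.

Local Notation gens := {: 'I_s * 'I_s}.

Definition gen (q : 'I_#|gens|) : A := y (enum_val q).1 ** y (enum_val q).2.

Lemma gen_product q : homogeneous_product (gen q).
Proof. by exists (y (enum_val q).1), (y (enum_val q).2); split=> //;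
  exact: homog_y. Qed.

Definition monomial (p : multinom (s + s) *l 'I_#|gens|) : A :=
  ops (word_of p.1) (gen p.2).

Lemma monomial_shift i a q : exists2 c : K, c != 0 &
  op i (monomial (a, q)) = c *: monomial (mnm_add a (mnm1 i), q).
Proof.
exact: (@ops_perm (i :: word_of a) _ _ (gen_product q) (perm_word_of_shift i a)).
Qed.

Lemma monomial_of_word w q : exists2 a, mdeg a = size w &
  proportional (ops w (gen q)) (monomial (a, q)).
Proof.
have [a pa] := perm_word_of w.
exists a; first by rewrite -size_word_of (perm_size pa).
exact: ops_perm (gen_product q) pa.
Qed.

(** Multiplying [z] by a word on either side moves the letters of the word to [z]
    one by one: [z(y_c u) ~ y_c(zu)] and [(u y_c)z ~ (uz)y_c] peel a letter off
    the result, while [z(u y_c) ~ u(z y_c)] and [(y_c u)z ~ (y_c z)u] move it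
    into [z] and swap the two factors, so that both sides have to be treated in
    one induction.  The innermost [y_i y_j] becomes two more letters. *)
Lemma mul_ops w q z : homogeneous_product z ->
  (exists2 w', size w' = (size w + 2)%N & proportional (z ** ops w (gen q))
    (ops w' z)) /\
  (exists2 w', size w' = (size w + 2)%N & proportional (ops w (gen q) ** z)
    (ops w' z)).
Proof.
elim: w z => [|i w IHw] z pz /=; have hz := homogeneous_product_homogeneous pz.
  rewrite /gen; move: (enum_val q) => [j k] /=; split.
    exists [:: lshift s j; rshift s k] => //=; rewrite op_lshift op_rshift.
    exact: lcomm.
  exists [:: rshift s k; lshift s j] => //=; rewrite op_lshift op_rshift.
  exact: rcomm.
have pu : homogeneous_product (ops w (gen q)) by apply: ops_product;
  exact: gen_product.
have hu := homogeneous_product_homogeneous pu.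
rewrite -(splitK i); case: (fintype.split i) => c /=;
  rewrite ?op_lshift ?op_rshift; split.
- have [[w' sw' eqw'] _] := IHw z pz; exists (lshift s c :: w');
  first by rewrite /= sw'.
  apply: (@proportional_trans _ _ (y c ** (z ** ops w (gen q))));
    first exact: lcomm.
  by rewrite /= op_lshift; exact: proportional_mull.
- have [[w' sw' eqw'] _] := IHw _ (op_product (lshift s c) pz).
  exists (rcons w' (lshift s c)); first by rewrite size_rcons sw'.
  rewrite /ops foldr_rcons; apply: proportional_trans eqw'; rewrite op_lshift.
  exact: rcomm.
- have [_ [w' sw' eqw']] := IHw _ (op_product (rshift s c) pz).
  exists (rcons w' (rshift s c)); first by rewrite size_rcons sw'.
  rewrite /ops foldr_rcons; apply: proportional_trans eqw'; rewrite op_rshift.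
  exact: lcomm.
have [_ [w' sw' eqw']] := IHw z pz; exists (rshift s c :: w');
  first by rewrite /= sw'.
apply: (@proportional_trans _ _ ((ops w (gen q) ** z) ** y c));
  first exact: rcomm.
by rewrite /= op_rshift; exact: proportional_mulr.
Qed.

Lemma product_of_generators n x : product_of (range y) n x ->
  (exists2 i, n = 1%N & x = y i) \/
  (exists2 wq : seq 'I_(s + s) * 'I_#|gens|, n = (size wq.1 + 2)%N &
     proportional x (ops wq.1 (gen wq.2))).
Proof.
elim=> [v [i _ <-]|m p u v _ IHu _ IHv]; first by left; exists i.
right; case: IHu IHv => [[i -> ->]|[[w q] /= -> xw]] [[j ->
  ->]|[[w' q'] /= -> yw]].
- exists ([::], enum_rank (i, j)) => //=.
  by rewrite /gen enum_rankK; exact: proportional_refl.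
- exists (lshift s i :: w', q') => //=.
  by rewrite op_lshift; exact: proportional_mull.
- exists (rshift s j :: w, q) => /=; first by rewrite addn1 addSn.
  by rewrite op_rshift; exact: proportional_mulr.
have [[w2 sw2 eqw2] _] := mul_ops w' q' (ops_product w (gen_product q)).
exists (w2 ++ w, q) => /=; first by rewrite size_cat sw2 addnC addnA.
rewrite /ops foldr_cat; apply: proportional_trans eqw2.
apply: (@proportional_trans _ _ (u ** ops w' (gen q')));
  first exact: proportional_mull.
exact: proportional_mulr.
Qed.

Lemma product_of_ops w q : product_of (range y) (size w + 2) (ops w (gen q)).
Proof.
have py i : product_of (range y) 1 (y i) by apply: product_of_one; exists i.
elim: w => [|i w IHw] /=; first exact: (product_of_mul (py _) (py _)).
rewrite -(splitK i); case: (fintype.split i) => c /=;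
  rewrite ?op_lshift ?op_rshift.
  exact: (product_of_mul (py c) IHw).
by rewrite addSn -addn1; exact: (product_of_mul IHw (py c)).
Qed.

End Bicommutative.

(** * Growth *)

Section Growth.
Variables (K : fieldType) (A : superalgebra K) (bicomA : bicommutative A).
Local Open Scope classical_set_scope.

(** The identity element and the generators themselves lie outside the monomial
    family; they add at most [s + 1] to the dimension.  A monomial of degree
    [n] is a product of [n + 2] generators, whence the factor [s + s + 2]. *)
Lemma homogeneous_growth (s : nat) (y : 'I_s -> A) :
  (forall i, homogeneous (y i)) ->
  (forall n, exists (J : finType) (f : J -> A),
     power_sum (linear_span (range y)) n `<=` linear_span (range f)) /\
  exists d, polynomial_growth d (growth (linear_span (range y))).
Proof.
move=> homog_y; set V := linear_span (range y).
have shift := monomial_shift bicomA homog_y.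
have [d [[C upper] lower]] := monomial_family_growth shift.
have span n : exists (J : finType) (f : J -> A),
    (#|J| <= (s + C * n.+1 ^ d).+1)%N /\ power_sum V n `<=` linear_span (range f).
  have [J [f [leJ spanf]]] := upper n.
  (* Without an identity element, zero fills this slot of the family. *)
  pose e : A := xget 0 (@identity_element K A).
  pose g (o : option ('I_s + J)) : A :=
    match o with None => e | Some (inl i) => y i | Some (inr j) => f j end.
  exists (option ('I_s + J))%type, g; split.
    by rewrite card_option card_sum card_ord ltnS leq_add2l.
  rewrite power_sum_span power_sumE; apply: linear_span_sub.
  move=> z [idz|[i lein /(product_of_generators bicomA homog_y)]].
    have -> : z = g None.
      by apply: (identity_unique idz); exact: (xgetPex 0 (ex_intro _ z idz)).
    by apply: sub_linear_span; exists None.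
  case=> [[j _ ->]|[[w q] /= ei zw]].
    by apply: sub_linear_span; exists (Some (inl j)).
  have [a da wa] := monomial_of_word bicomA homog_y w q.
  apply: proportional_span (proportional_trans zw wa) _.
  have : linear_span (range f) (monomial y (a, q)).
    by apply: spanf; rewrite da; apply: leq_trans lein; rewrite ei leq_addr.
  by apply: linear_spanS => _ [j _ <-]; exists (Some (inr j)).
split=> [n|]; first by have [J [f [_ Jf]]] := span n; exists J, f.
exists d; split=> [|d_gt0].
  exists (s.+1 + C * 2 ^ d)%N => n n_gt0; have [J [f [leJ Jf]]] := span n.
  apply: leq_trans (dimension_le_card (power_sum_submod V n) Jf) _.
  apply: leq_trans leJ _; rewrite -addSn mulnDl leq_add //.
    by rewrite leq_pmulr // expn_gt0 n_gt0.
  rewrite -mulnA leq_mul2l -expnMn; apply/orP; right.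
  have [->|d_gt0] := posnP d; first by rewrite !expn0.
  by rewrite leq_exp2r // mul2n -addnn -addn1 leq_add2l.
exists (s + s + 2)%N; first by rewrite addn2.
case=> [|n]; first by rewrite exp0n.
have [J [u [leJ indep_u degu]]] := lower d_gt0 n.+1.
apply: leq_trans leJ _; have [I [f [_ If]]] := span ((s + s + 2) * n.+1)%N.
apply: (independent_le_dimension (power_sum_submod _ _) If indep_u) => x.
rewrite power_sum_span power_sumE; apply: sub_linear_span; right.
have := product_of_ops y (word_of (u x).1) (u x).2.
rewrite size_word_of; exists (mdeg (u x).1 + 2)%N => //.
rewrite mulnDl leq_add ?degu //; exact: leq_pmulr.
Qed.

End Growth.

Theorem theorem4p11 (R : realType) (K : fieldType) (A : superalgebra K)
    (charK : 2%N \notin [pchar K])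
    (bicomA : bicommutative A)
    (fgA : finitely_generated A) :
  exists d : nat, GKdim_eq A (d%:R%:E : \bar R).
Proof.
have [X0 /homogeneous_generators[Y genY homogY]] := fgA.
pose y := tnth (in_tuple Y).
have rangeY : [set` Y]%classic = range y.
  apply/seteqP; split=> [x /= /seq_tnthP[i ->]|_ [i _ <-]]; first by exists i.
  exact: mem_tnth.
have homog_y i : homogeneous (y i) by apply: homogY; exact: mem_tnth.
have [finY [d growthY]] := homogeneous_growth bicomA homog_y.
exists d => X genX.
have [k k_gt0 XY] := generates_comparable X genY.
have [l l_gt0 YX] := generates_comparable Y genX.
rewrite rangeY in XY YX.
have finX n : exists (J : finType) (f : J -> A),
    (power_sum (linear_span [set` X]) n `<=` linear_span (range f))%classic.
  have [J [f Jf]] := finY (k * n)%N; exists J, f.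
  by apply: subset_trans Jf; exact: XY.
apply: limn_esup_log => [m n lemn|].
  have [J [f Jf]] := finX n.
  by apply: dimensionS Jf (power_sumS lemn); exact: power_sum_submod.
apply: (polynomial_growth_rescale k_gt0 l_gt0 _ _ growthY) => n.
  have [J [f Jf]] := finY (k * n)%N.
  by apply: dimensionS Jf (XY n); exact: power_sum_submod.
have [J [f Jf]] := finX (l * n)%N.
by apply: dimensionS Jf (YX n); exact: power_sum_submod.
Qed.
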